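(* Let $\rho>0$ and assume $\Gamma(0)<\Gamma(1)$ and $1+\rho\ln\mu(0)<0$. Let $\nu_\star(\rho)$ be the unique solution in $(0,\mu(1))$ of $1+\rho\ln G(\nu,\mu(1))=0$. Then for every $\rho$-admissible scaling $n\mapsto L_n$, \[ \lim_{n\to\infty}\mathbb{P}\big[\mathbb{M}(n;L_n)\text{ contains no isolated nodes}\big]=\begin{cases}0 & \text{if } 1+\rho\ln\big(\Gamma(1)^{\nu_\star(\rho)}\Gamma(0)^{1-\nu_\star(\rho)}\big)<0,\\ 1 & \text{if } 1+\rho\ln\big(\Gamma(1)^{\nu_\star(\rho)}\Gamma(0)^{1-\nu_\star(\rho)}\big)>0.\end{cases} \]
   Context: Homogeneous binary MAG model. Fix $\mu(0),\mu(1)\in(0,1)$ with $\mu(0)+\mu(1)=1$, and a symmetric $2\times2$ matrix $(q(a,b))_{a,b\in\{0,1\}}$ with $q(0,1)=q(1,0)$ and $0<q(a,b)<1$. On a probability space, let $\{A, A_\ell(u):\ell,u\ge1\}$ be i.i.d. $\{0,1\}$-valued with $\mathbb{P}[A=1]=\mu(1)$, and independently let $\{U(u,v):1\le u<v\}$ be i.i.d. uniform on $(0,1)$, $U(v,u)=U(u,v)$. For $L\ge1$, $\mathbf{A}_L(u)=(A_1(u),\dots,A_L(u))$, $Q_L(\mathbf a,\mathbf b)=\prod_{\ell=1}^L q(a_\ell,b_\ell)$. The graph $\mathbb{M}(n;L)$ on $\{1,\dots,n\}$ has an edge between distinct $u,v$ iff $U(u,v)\le Q_L(\mathbf A_L(u),\mathbf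 A_L(v))$; a node is isolated if it has no neighbor. $\Gamma(a)=\mathbb{E}[q(a,A)]=q(a,0)\mu(0)+q(a,1)\mu(1)$. A scaling $n\mapsto L_n$ of positive integers is $\rho$-admissible if $L_n\sim\rho\ln n$. For $0<\nu,\mu<1$, $G(\nu,\mu)=(\mu/\nu)^\nu\big((1-\mu)/(1-\nu)\big)^{1-\nu}$, extended continuously to $\nu\in[0,1]$ by $G(0,\mu)=1-\mu$, $G(1,\mu)=\mu$. *)

(* Defs.v *)
From HB Require Import structures.
From mathcomp Require Import all_boot all_order all_algebra.
From mathcomp Require Import all_classical all_reals all_analysis.
Set Implicit Arguments. Unset Strict Implicit. Unset Printing Implicit Defensive.
Import Order.TTheory GRing.Theory Num.Theory.
Import numFieldNormedType.Exports.
Local Open Scope classical_set_scope.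
Local Open Scope ring_scope.

Section MAG.
Variable R : realType.

(* Gamma(a) = E[q(a,A)] = q(a,0) mu(0) + q(a,1) mu(1); the attribute value
   0 is encoded by [false] and 1 by [true]. *)
Definition Gamma (mu : bool -> R) (q : bool -> bool -> R) (a : bool) : R :=
  q a false * mu false + q a true * mu true.

(* G(nu,m) = (m/nu)^nu ((1-m)/(1-nu))^(1-nu), extended continuously to
   nu = 0 (value 1 - m) and nu = 1 (value m). *)
Definition Gfun (nu m : R) : R :=
  if nu == 0 then 1 - m
  else if nu == 1 then m
  else (m / nu) `^ nu * ((1 - m) / (1 - nu)) `^ (1 - nu).

Definition QL (q : bool -> bool -> R) (L : nat) (a b : {ffun 'I_L -> bool}) : R :=
  \prod_(l < L) q (a l) (b l).

(* Probability of a given attribute configuration of the n nodes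
   (i.i.d. attributes with P[A = b] = mu b). *)
Definition attr_weight (mu : bool -> R) (n L : nat)
    (a : {ffun 'I_n -> {ffun 'I_L -> bool}}) : R :=
  \prod_(u < n) \prod_(l < L) mu (a u l).

(* Edge sets are sets of pairs (u,v) with u < v. *)
Definition lt_pairs (n : nat) : {set 'I_n * 'I_n} :=
  [set p : 'I_n * 'I_n | (val p.1 < val p.2)%N].

(* Conditional probability (given the attributes) that the edge set of
   M(n;L) is exactly E: edges present independently, {u,v} with
   probability Q_L(A(u),A(v)) (i.e. U(u,v) <= Q_L). *)
Definition edge_weight (q : bool -> bool -> R) (n L : nat)
    (a : {ffun 'I_n -> {ffun 'I_L -> bool}}) (E : {set 'I_n * 'I_n}) : R :=
  \prod_(p in lt_pairs n)
     (if p \in E then QL q (a p.1) (a p.2) else 1 - QL q (a p.1) (a p.2)).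

Definition isolated (n : nat) (E : {set 'I_n * 'I_n}) (u : 'I_n) : bool :=
  [forall v, ((u, v) \notin E) && ((v, u) \notin E)].

Definition no_isolated (n : nat) (E : {set 'I_n * 'I_n}) : bool :=
  [forall u, ~~ isolated E u].

Definition prob_no_isolated (mu : bool -> R) (q : bool -> bool -> R)
    (n L : nat) : R :=
  \sum_(a : {ffun 'I_n -> {ffun 'I_L -> bool}})
     attr_weight mu a *
     \sum_(E : {set 'I_n * 'I_n} | (E \subset lt_pairs n) && no_isolated E)
        edge_weight q a E.

Definition admissible (rho : R) (L : nat -> nat) : Prop :=
  (forall n, (0 < L n)%N) /\
  (fun n : nat => (L n)%:R / (rho * ln (n%:R : R))) @ \oo --> (1 : R).

End MAG.

(* Main.v *)
(* Write [Gam(a)] for the product of the [Gamma(a_l)]. Given the attribute vector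
   [a] of a node, its edges are independent, so it is isolated with probability
   [(1 - Gam(a))^(n-1)]. If a fraction [t] of the entries of [a] is 1, then
   [Gam(a) = exp(L h(t))], where [h(t) = t ln Gamma(1) + (1-t) ln Gamma(0)], and
   such vectors have total probability about [G(t, mu(1))^L]. Since [L] is about
   [rho ln n], nodes with [t < nu_star] do not occur, whereas those with [t] just
   above [nu_star] are plentiful.
   One law: by the union bound, over the nodes with [t <= t1 < nu_star] (Chernoff
   bound) and over the others, for which [n Gam(a)] is at least a power of [n].
   Zero law: for a window of fractions just above [nu_star], [n Gam(a)] tends to 0
   while the mean number of nodes in the window tends to infinity, by a change of
   measure and Chebyshev's inequality; hence some of them is isolated. Since
   attribute vectors are independent, only the variance of the number of nodes in
   the window is needed, not that of the number of isolated nodes. *)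

Require Import Defs.
From HB Require Import structures.
From mathcomp Require Import all_boot all_order all_algebra.
From mathcomp Require Import all_classical all_reals all_analysis.
From mathcomp Require Import ring lra.
Import Order.TTheory GRing.Theory Num.Theory.
Import numFieldNormedType.Exports.
Local Open Scope classical_set_scope.
Local Open Scope ring_scope.

Set Implicit Arguments.
Unset Strict Implicit.
Unset Printing Implicit Defensive.

(** * Sums over i.i.d. families *)

Section IidSums.
Variables (R : realFieldType) (I T : finType) (w : T -> R).
Hypothesis w1 : \sum_c w c = 1.

(** Conditioning on the value [b] at [u]: by independence the factors at the other coordinates
    average separately. *)
Lemma sum_iid_cond (u : I) (g : T -> R) (h : I -> T -> T -> R) :
  \sum_(a : {ffun I -> T})
     (\prod_v w (a v)) * (g (a u) * \prod_(v | v != u) h v (a u) (a v)) =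
  \sum_b w b * (g b * \prod_(v | v != u) \sum_c w c * h v b c).
Proof.
(* The indicator [c == b] at [u] makes each summand a product over coordinates, to which
   distributivity applies. *)
pose F b v c := if v == u then (c == b)%:R * (w b * g b) else w c * h v b c.
transitivity (\sum_b \sum_(a : {ffun I -> T}) \prod_v F b v (a v)).
  rewrite exchange_big; apply: eq_bigr => a _ /=.
  rewrite (bigD1 (a u)) //= [X in _ = _ + X]big1 ?addr0 => [|b /negPf b_au].
    have -> : \prod_v w (a v) = w (a u) * \prod_(v | v != u) w (a v).
      by rewrite (bigD1 u).
    rewrite [RHS](bigD1 u) //= {1}/F !eqxx mul1r -!mulrA.
    congr (_ * _); rewrite mulrCA; congr (_ * _).
    by rewrite -big_split /=; apply: eq_bigr => v /negPf vu; rewrite /F vu.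
  by rewrite (bigD1 u) //= /F eqxx eq_sym b_au !mul0r.
apply: eq_bigr => b _; rewrite -bigA_distr_bigA (bigD1 u) //=.
have -> : \sum_c F b u c = w b * g b.
  rewrite (bigD1 b) //= {1}/F !eqxx mul1r big1 ?addr0 // => c /negPf cb.
  by rewrite /F eqxx cb mul0r.
rewrite -mulrA; congr (_ * (_ * _)); apply: eq_bigr => v /negPf vu.
by rewrite /F vu.
Qed.

Lemma sum_iid_marginal (u : I) (g : T -> R) :
  \sum_(a : {ffun I -> T}) (\prod_v w (a v)) * g (a u) = \sum_b w b * g b.
Proof.
transitivity (\sum_b w b * (g b * \prod_(v | v != u) \sum_c w c * 1)).
  rewrite -(sum_iid_cond u g (fun _ _ _ => 1)).
  by apply: eq_bigr => a _; rewrite big1_eq mulr1.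
apply: eq_bigr => b _; rewrite big1 ?mulr1 // => v _.
by under eq_bigr do rewrite mulr1.
Qed.

Lemma sum_iid1 : \sum_(a : {ffun I -> T}) \prod_v w (a v) = 1.
Proof. by rewrite -(bigA_distr_bigA (fun _ => w)) big1. Qed.

Lemma sum_iid_pair (u v : I) (f g : T -> R) : v != u ->
  \sum_(a : {ffun I -> T}) (\prod_i w (a i)) * (f (a u) * g (a v)) =
  (\sum_b w b * f b) * (\sum_b w b * g b).
Proof.
move=> vu; pose h (i : I) (_ c : T) := if i == v then g c else 1.
rewrite mulr_suml.
transitivity (\sum_b w b * (f b * \prod_(i | i != u) \sum_c w c * h i b c)).
  rewrite -sum_iid_cond; apply: eq_bigr => a _; congr (_ * (_ * _)).
  rewrite (bigD1 v) //= /h eqxx big1 ?mulr1 // => i /andP[_ /negPf].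
  by move->.
apply: eq_bigr => b _; rewrite (bigD1 v) //= /h eqxx -mulrA.
congr (_ * (_ * _)); rewrite -[RHS]mulr1; congr (_ * _); apply: big1.
by move=> i /andP[_ /negPf->]; under eq_bigr do rewrite mulr1.
Qed.

(** For centred [g] the cross terms vanish by independence, which leaves the diagonal. *)
Lemma sum_iid_variance (g : T -> R) : \sum_c w c * g c = 0 ->
  \sum_(a : {ffun I -> T}) (\prod_v w (a v)) * (\sum_u g (a u)) ^+ 2 =
  #|I|%:R * \sum_c w c * g c ^+ 2.
Proof.
move=> g0.
transitivity (\sum_(u : I) \sum_(v : I) \sum_(a : {ffun I -> T})
                (\prod_i w (a i)) * (g (a u) * g (a v))).
  under [RHS]eq_bigr do rewrite exchange_big /=.
  rewrite [RHS]exchange_big /=; apply: eq_bigr => a _.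
  under [RHS]eq_bigr do rewrite -mulr_sumr.
  by rewrite -mulr_sumr expr2 big_distrlr.
rewrite -sum1_card natr_sum mulr_suml; apply: eq_bigr => u _.
rewrite mul1r (bigD1 u) //= [X in _ + X]big1 ?addr0 => [|v vu].
  by rewrite (sum_iid_marginal u (fun b => g b * g b)).
by rewrite sum_iid_pair // g0 mul0r.
Qed.

End IidSums.

(** * Isolated nodes given the attributes *)

(** Expansion of a product over all of [P] whose factors off [D] are [0 + 1]; the 0 kills every [E]
    not contained in [D]. *)
Lemma sum_subset_prod (R : comPzRingType) (P : finType) (D : {set P})
    (F G : P -> R) :
  \sum_(E : {set P} | E \subset D) \prod_(p in D) (if p \in E then F p else G p)
  = \prod_(p in D) (F p + G p).
Proof.
pose F' p := if p \in D then F p else 0.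
pose G' p := if p \in D then G p else 1.
transitivity (\prod_p (F' p + G' p)); last first.
  rewrite [RHS]big_mkcond /=; apply: eq_bigr => p _; rewrite /F' /G'.
  by case: ifP => //; rewrite add0r.
rewrite bigA_distr big_mkcond /=; apply: eq_bigr => E _.
have [ED|/subsetPn[p pE pD]] := boolP (E \subset D); last first.
  by rewrite (bigD1 p) //= pE /F' (negPf pD) mul0r.
rewrite [LHS]big_mkcond /=; apply: eq_bigr => p _; rewrite /F' /G'.
have [//|pD] := boolP (p \in D).
by case: ifP => // /(fintype.subsetP ED); rewrite (negPf pD).
Qed.

Section RandomEdges.
Variables (R : realType) (q : bool -> bool -> R) (n L : nat).
Hypotheses (q_sym : q false true = q true false)
  (q01 : forall a b, 0 < q a b < 1).
Implicit Types (a : {ffun 'I_n -> {ffun 'I_L -> bool}}) (E : {set 'I_n * 'I_n}).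

Lemma QL_sym (b c : {ffun 'I_L -> bool}) : QL q b c = QL q c b.
Proof. by apply: eq_bigr => l _; case: (b l); case: (c l). Qed.

Lemma QL_itv (b c : {ffun 'I_L -> bool}) : 0 <= QL q b c <= 1.
Proof.
apply/andP; split; first by apply: prodr_ge0 => l _; have /andP[/ltW] := q01 (b l) (c l).
by apply: prodr_ile1 => l _; have /andP[/ltW-> /ltW->] := q01 (b l) (c l).
Qed.

Lemma edge_weight_ge0 a E : 0 <= edge_weight q a E.
Proof.
apply: prodr_ge0 => p _; have /andP[? ?] := QL_itv (a p.1) (a p.2).
by case: ifP => // _; rewrite subr_ge0.
Qed.

Lemma sum_edge_weight a :
  \sum_(E : {set 'I_n * 'I_n} | E \subset lt_pairs n) edge_weight q a E = 1.
Proof.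
rewrite /edge_weight (sum_subset_prod _ (fun p => QL q (a p.1) (a p.2))
  (fun p => 1 - QL q (a p.1) (a p.2))) big1 // => p _.
by rewrite addrC subrK.
Qed.

(** A pair at [u] is stored as [(u, v)] or [(v, u)] according to the order; reindexing by the other
    endpoint [v] removes the distinction. *)
Lemma prod_incident (u : 'I_n) (x : 'I_n -> 'I_n -> R) :
  (forall v w, x v w = x w v) ->
  \prod_(p in lt_pairs n | (p.1 == u) || (p.2 == u)) x p.1 p.2 =
  \prod_(v | v != u) x u v.
Proof.
move=> x_sym; pose pair (v : 'I_n) := if (v < u)%N then (v, u) else (u, v).
pose other (p : 'I_n * 'I_n) := if p.1 == u then p.2 else p.1.
have pairK v : other (pair v) = v.
  by rewrite /other /pair; case: ltnP => /=; rewrite ?eqxx //; case: eqP => // ->.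
rewrite (reindex_onto pair other) => [|[v w]]; last first.
  rewrite inE /pair /other /=; have [-> /andP[uw _]|vu /=] := eqVneq v u.
    by rewrite ltnNge (ltnW uw).
  by move=> /andP[vw /eqP wu]; rewrite -wu vw.
apply: eq_big => v; last by rewrite /pair; case: ifP.
rewrite pairK eqxx andbT inE /pair; case: (ltnP v u) => /= uv.
  by rewrite uv eqxx orbT -val_eqE neq_ltn uv.
by rewrite eqxx andbT ltn_neqAle uv andbT eq_sym.
Qed.

(** Isolation of [u] replaces by 0 the presence factor of each pair at [u]; every other pair
    contributes [x + (1 - x) = 1]. *)
Lemma sum_edge_weight_isolated a (u : 'I_n) :
  \sum_(E : {set 'I_n * 'I_n} | (E \subset lt_pairs n) && Defs.isolated E u)
     edge_weight q a E = \prod_(v | v != u) (1 - QL q (a u) (a v)).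
Proof.
pose inc (p : 'I_n * 'I_n) := (p.1 == u) || (p.2 == u).
pose x p := QL q (a p.1) (a p.2).
transitivity (\prod_(p in lt_pairs n) ((if inc p then 0 else x p) + (1 - x p))).
  rewrite -sum_subset_prod big_mkcondr /=; apply: eq_bigr => E ED.
  have [/forallP iso|] := boolP (Defs.isolated E u).
    apply: eq_bigr => p _; have [pE|//] := boolP (p \in E).
    case: ifP => // /orP[] /eqP pu; case: p pE pu => v w /= pE pu;
      by have := iso v; have := iso w; rewrite -pu pE ?andbF.
  case/forallPn => v; rewrite negb_and !negbK => vE.
  have [p pE pu] : exists2 p, p \in E & inc p.
    by case/orP: vE => ?; [exists (u, v)|exists (v, u)]; rewrite // /inc eqxx ?orbT.
  by rewrite (bigD1 p) ?(fintype.subsetP ED) //= pE pu mul0r.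
rewrite -(@prod_incident u (fun v w => 1 - QL q (a v) (a w))); last first.
  by move=> v w; rewrite QL_sym.
rewrite big_mkcondr /=; apply: eq_bigr => p _; rewrite -/(inc p) /x.
by case: ifP => _; rewrite ?add0r // addrC subrK.
Qed.

End RandomEdges.

(** * Non-asymptotic bounds *)

Lemma bernoulli_le (R : realDomainType) (x : R) (m : nat) :
  0 <= x <= 1 -> 1 - m%:R * x <= (1 - x) ^+ m.
Proof.
move=> /andP[x0 x1]; elim: m => [|m IHm]; first by rewrite mul0r subr0 expr0.
rewrite exprS; have : (1 - x) * (1 - m%:R * x) <= (1 - x) * (1 - x) ^+ m.
  by rewrite ler_wpM2l // subr_ge0.
apply: le_trans; rewrite -natr1.
have : 0 <= m%:R * x * x by rewrite !mulr_ge0.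
by lra.
Qed.

(** With [x = mu] this is the probability of the vector [b], with [x = bern t] its probability under
    a tilted law, and with [x = Gamma mu q] the chance that a random node is adjacent to one with
    attributes [b]. *)
Definition vprod (R : realType) (L : nat) (x : bool -> R)
    (b : {ffun 'I_L -> bool}) : R := \prod_(l < L) x (b l).

Section ConnectivityBounds.
Variables (R : realType) (mu : bool -> R) (q : bool -> bool -> R) (n L : nat).
Hypotheses (mu01 : forall b, 0 < mu b < 1) (mu_sum1 : mu false + mu true = 1)
  (q_sym : q false true = q true false) (q01 : forall a b, 0 < q a b < 1).

Local Notation vec := {ffun 'I_L -> bool}.
Local Notation w := (@vprod R L mu).
Local Notation Gam := (@vprod R L (Gamma mu q)).

Lemma sum_bool (V : nmodType) (f : bool -> V) : \sum_b f b = f false + f true.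
Proof. by rewrite big_bool addrC. Qed.

Lemma Gamma_itv b : 0 < Gamma mu q b < 1.
Proof.
have /andP[m0 _] := mu01 false; have /andP[m1 _] := mu01 true.
have /andP[q0 Q0] := q01 b false; have /andP[q1 Q1] := q01 b true.
have := mulr_gt0 q0 m0; have := mulr_gt0 q1 m1.
have := Q0; rewrite -(ltr_pM2r m0) => h0; have := Q1; rewrite -(ltr_pM2r m1) => h1.
by rewrite /Gamma => h2 h3; apply/andP; split; move: mu_sum1; lra.
Qed.

Lemma prod_Gamma_itv (b : vec) : 0 <= Gam b <= 1.
Proof.
apply/andP; split.
  by apply: prodr_ge0 => l _; have /andP[/ltW] := Gamma_itv (b l).
by apply: prodr_ile1 => l _; have /andP[/ltW-> /ltW->] := Gamma_itv (b l).
Qed.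

Lemma node_weight_ge0 (b : vec) : 0 <= w b.
Proof. by apply: prodr_ge0 => l _; have /andP[/ltW] := mu01 (b l). Qed.

Lemma attr_weight_ge0 (a : {ffun 'I_n -> vec}) : 0 <= attr_weight mu a.
Proof. by apply: prodr_ge0 => u _; exact: node_weight_ge0. Qed.

Lemma sum_node_weight : \sum_b w b = 1.
Proof. by apply: sum_iid1; rewrite sum_bool. Qed.

Lemma sum_attr_weight : \sum_(a : {ffun 'I_n -> vec}) attr_weight mu a = 1.
Proof. exact: (sum_iid1 _ sum_node_weight). Qed.

Lemma sum_not_adjacent (b : vec) :
  \sum_c w c * (1 - QL q b c) = 1 - Gam b.
Proof.
under eq_bigr do rewrite mulrBr mulr1.
rewrite big_split /= sum_node_weight sumrN; congr (1 - _).
transitivity (\sum_(c : vec) \prod_l (mu (c l) * q (b l) (c l))).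
  by apply: eq_bigr => c _; rewrite [RHS]big_split.
rewrite -(bigA_distr_bigA (fun l c => mu c * q (b l) c)).
by apply: eq_bigr => l _; rewrite sum_bool /Gamma ![mu _ * _]mulrC.
Qed.

(** The weight [g] is 1 in the union bound and the indicator of a set of vectors in the zero law. *)
Lemma sum_attr_isolated (u : 'I_n) (g : vec -> R) :
  \sum_a attr_weight mu a *
     (g (a u) * \prod_(v | v != u) (1 - QL q (a u) (a v))) =
  \sum_b w b * (g b * (1 - Gam b) ^+ n.-1).
Proof.
rewrite (sum_iid_cond w u g (fun _ b c => 1 - QL q b c)).
apply: eq_bigr => b _; congr (_ * (_ * _)).
under eq_bigr do rewrite sum_not_adjacent.
by rewrite prodr_const -[in RHS](card_ord n) -(cardC1 u).
Qed.

Lemma prob_no_isolated_le1 : prob_no_isolated mu q n L <= 1.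
Proof.
rewrite -sum_attr_weight; apply: ler_sum => a _.
rewrite ler_piMr ?attr_weight_ge0 // -(sum_edge_weight q a) big_mkcondr /=.
by apply: ler_sum => E _; case: ifP => // _; exact: edge_weight_ge0.
Qed.

Lemma prob_no_isolated_ge0 : 0 <= prob_no_isolated mu q n L.
Proof.
apply: sumr_ge0 => a _; rewrite mulr_ge0 ?attr_weight_ge0 //.
by apply: sumr_ge0 => E _; exact: edge_weight_ge0.
Qed.

Lemma prob_no_isolated_ge :
  1 - n%:R * \sum_b w b * (1 - Gam b) ^+ n.-1 <= prob_no_isolated mu q n L.
Proof.
pose iso (a : {ffun 'I_n -> vec}) := \sum_u \prod_(v | v != u) (1 - QL q (a u) (a v)).
have -> : n%:R * \sum_b w b * (1 - Gam b) ^+ n.-1 = \sum_a attr_weight mu a * iso a.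
  under [RHS]eq_bigr do rewrite mulr_sumr.
  rewrite exchange_big /= -[X in X%:R](card_ord n) -sum1_card natr_sum mulr_suml.
  apply: eq_bigr => u _; rewrite mul1r.
  transitivity (\sum_b w b * (1 * (1 - Gam b) ^+ n.-1)).
    by apply: eq_bigr => b _; rewrite mul1r.
  by rewrite -(sum_attr_isolated u (fun=> 1)); apply: eq_bigr => a _; rewrite mul1r.
rewrite -sum_attr_weight -sumrB; apply: ler_sum => a _.
rewrite -{1}[attr_weight mu a]mulr1 -mulrBr ler_wpM2l ?attr_weight_ge0 //.
have -> : iso a = \sum_u \sum_(E : {set 'I_n * 'I_n} | E \subset lt_pairs n)
    if Defs.isolated E u then edge_weight q a E else 0.
  by apply: eq_bigr => u _; rewrite -big_mkcondr sum_edge_weight_isolated.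
(* Union bound, one edge set at a time: 1 minus the number of isolated nodes is at most the
   indicator that there are none. *)
rewrite -(sum_edge_weight q a) exchange_big /= -sumrB [leRHS]big_mkcondr /=.
apply: ler_sum => E _; have w0 := edge_weight_ge0 q01 a E.
case: ifP => [_|/negbT/forallPn[u]].
  by rewrite gerBl; apply: sumr_ge0 => u _; case: ifP.
rewrite negbK => isou; rewrite (bigD1 u) //= isou opprD addrA subrr sub0r oppr_le0.
by apply: sumr_ge0 => v _; case: ifP.
Qed.

(* Let [N] be the number of nodes with attributes in [tau], of mean [t], and [X]
   the number of isolated ones. If [X = 0] then
   [2 (N - X) / t + (1 - N / t)^2 = 1 + (N / t)^2 >= 1]. *)
Lemma prob_no_isolated_le (tau : pred vec) (p : R) :
  (forall b, tau b -> Gam b <= p) ->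
  let t := n%:R * \sum_(b | tau b) w b in
  0 < t -> prob_no_isolated mu q n L <= 2 * n%:R * p + t^-1.
Proof.
move=> Gamp t t0; pose P := \sum_(b | tau b) w b.
pose N (a : {ffun 'I_n -> vec}) : R := \sum_u (tau (a u))%:R.
pose niso (a : {ffun 'I_n -> vec}) u : R :=
  1 - \prod_(v | v != u) (1 - QL q (a u) (a v)).
(* [B a] is the conditional mean of [2 (N - X) / t + (1 - N / t)^2] given the attributes [a]. *)
pose B (a : {ffun 'I_n -> vec}) := 2 / t * (\sum_u (tau (a u))%:R * niso a u) + (1 - N a / t) ^+ 2.
have PE : P = \sum_b w b * (tau b)%:R.
  by rewrite /P big_mkcond /=; apply: eq_bigr => b _; rewrite mulrb; case: ifP; rewrite ?mulr1 ?mulr0.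
have n0 : 0 < n%:R :> R.
  by rewrite lt0r ler0n andbT; apply: contraTneq t0 => n0; rewrite /t n0 mul0r ltxx.
have P0 : 0 < P by rewrite -(pmulr_rgt0 _ n0).
apply: (@le_trans _ _ (\sum_a attr_weight mu a * B a)).
  apply: ler_sum => a _; rewrite ler_wpM2l ?attr_weight_ge0 //.
  have -> : B a = \sum_(E : {set 'I_n * 'I_n} | E \subset lt_pairs n)
      edge_weight q a E * (2 / t * (\sum_u (tau (a u))%:R * (~~ Defs.isolated E u)%:R)
        + (1 - N a / t) ^+ 2).
    under eq_bigr do rewrite mulrDr.
    rewrite big_split /= -mulr_suml sum_edge_weight mul1r; congr (_ + _).
    under [RHS]eq_bigr do rewrite mulrCA.
    rewrite -mulr_sumr; congr (_ * _).
    under [RHS]eq_bigr do rewrite mulr_sumr.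
    rewrite exchange_big /=; apply: eq_bigr => u _.
    under [RHS]eq_bigr do rewrite mulrCA.
    rewrite -mulr_sumr; congr (_ * _); rewrite /niso -sum_edge_weight_isolated //.
    rewrite -{1}(sum_edge_weight q a) big_mkcondr /= -sumrB; apply: eq_bigr => E _.
    by case: (Defs.isolated E u) => /=; rewrite ?subrr ?mulr0 ?subr0 ?mulr1.
  rewrite big_mkcondr /=; apply: ler_sum => E _.
  have w0 := edge_weight_ge0 q01 a E.
  case: ifP => [/forallP noiso|_]; last first.
    rewrite mulr_ge0 // addr_ge0 ?sqr_ge0 // mulr_ge0 ?divr_ge0 ?(ltW t0) //.
    by apply: sumr_ge0 => u _; rewrite mulr_ge0.
  rewrite ler_peMr //; under eq_bigr do rewrite noiso mulr1.
  rewrite -/(N a) -mulrA [t^-1 * _]mulrC; set y := N a / t.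
  by have := sqr_ge0 y; lra.
under eq_bigr do rewrite mulrDr.
rewrite big_split /=; apply: lerD.
  under eq_bigr do rewrite mulrCA mulr_sumr.
  rewrite -mulr_sumr exchange_big /=.
  apply: (@le_trans _ _ (2 / t * \sum_(u < n) P * (n%:R * p))).
    rewrite ler_wpM2l ?divr_ge0 ?(ltW t0) //; apply: ler_sum => u _.
    have -> : \sum_a attr_weight mu a * ((tau (a u))%:R * niso a u) =
        \sum_b w b * (tau b)%:R * (1 - (1 - Gam b) ^+ n.-1).
      under eq_bigr do rewrite /niso mulrBr mulr1 mulrBr.
      under [RHS]eq_bigr do rewrite mulrBr mulr1 -mulrA.
      rewrite !sumrB; congr (_ - _).
        exact: (sum_iid_marginal sum_node_weight u (fun b => (tau b)%:R)).
      exact: (sum_attr_isolated u (fun b => (tau b)%:R)).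
    rewrite PE mulr_suml; apply: ler_sum => b _.
    have [tb|_] := boolP (tau b); last by rewrite mulr0 !mul0r.
    rewrite mulr1 ler_wpM2l ?node_weight_ge0 //.
    have /andP[G0 G1] := prod_Gamma_itv b.
    rewrite lerBlDr -lerBlDl.
    (* A node with vector [b] has a neighbour with probability at most [n.-1 * Gam b], hence at most
       [n * p]. *)
    apply: le_trans (bernoulli_le n.-1 (prod_Gamma_itv b)).
    rewrite lerB // ler_pM ?Gamp // ler_nat; exact: leq_pred.
  rewrite sumr_const card_ord -[_ *+ n]mulr_natl.
  have -> : n%:R * (P * (n%:R * p)) = t * (n%:R * p) by rewrite mulrA.
  by rewrite -mulrA mulKf ?mulrA // gt_eqF.
(* [g] is centred with second moment [P - P^2], so the variance term is
   [n (P - P^2) / t^2 <= 1 / t]. *)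
pose g b : R := P - (tau b)%:R.
have g0 : \sum_b w b * g b = 0.
  under eq_bigr do rewrite mulrBr.
  by rewrite sumrB -mulr_suml sum_node_weight mul1r -PE subrr.
have -> : \sum_a attr_weight mu a * (1 - N a / t) ^+ 2 =
    (n%:R * \sum_b w b * g b ^+ 2) / t ^+ 2.
  have := sum_iid_variance 'I_n sum_node_weight g0.
  rewrite card_ord => <-; rewrite mulr_suml; apply: eq_bigr => a _.
  rewrite -mulrA; congr (_ * _); rewrite -expr_div_n; congr (_ ^+ 2).
  rewrite /g sumrB sumr_const card_ord -[_ *+ n]mulr_natl mulrBl.
  by rewrite -/t mulfV ?gt_eqF.
have -> : \sum_b w b * g b ^+ 2 = P - P ^+ 2.
  transitivity (\sum_b (w b * (tau b)%:R * (1 - 2 * P) + w b * P ^+ 2)).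
    apply: eq_bigr => b _; rewrite -mulrA -mulrDr; congr (_ * _); rewrite /g.
    by case: (tau b); rewrite /=; ring.
  by rewrite big_split /= -!mulr_suml -PE sum_node_weight; ring.
rewrite ler_pdivrMr ?exprn_gt0 // [t ^+ 2]expr2 mulKf ?gt_eqF // /t.
by rewrite ler_pM2l // -/P gerBl sqr_ge0.
Qed.

End ConnectivityBounds.

(** * Large deviations of the fraction of ones *)

Section LargeDeviations.
Variable R : realType.

(** [L] times its value at the fraction of ones of [b] is the logarithm of [vprod x b]. It is affine
    in [t]. *)
Definition logmix (x : bool -> R) (t : R) : R :=
  t * ln (x true) + (1 - t) * ln (x false).

Definition bern (t : R) (b : bool) : R := if b then t else 1 - t.

(* The exponential decay rate of the probability that a fraction [t] of the
   attributes is 1; equals [ln (Gfun t (mu true))]. *)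
Definition rate (mu : bool -> R) (t : R) : R :=
  logmix (fun b => mu b / bern t b) t.

Definition freq (L : nat) (b : {ffun 'I_L -> bool}) : R :=
  (\sum_l (b l)%:R) / L%:R.

Lemma logmix_le (x : bool -> R) (s t : R) :
  0 < x false -> x false <= x true -> s <= t -> logmix x s <= logmix x t.
Proof.
move=> x0 x01 st; have : ln (x false) <= ln (x true).
  by rewrite ler_ln ?posrE // (lt_le_trans x0).
by rewrite /logmix; nra.
Qed.

Lemma ln_lt_subr1 (x : R) : 0 < x -> x != 1 -> ln x < x - 1.
Proof.
move=> x0 x1; have : ln x != 0 by rewrite ln_eq0.
by move=> /expR_gt1Dx; rewrite lnK ?posrE //; lra.
Qed.

Lemma bern_gt0 (t : R) : 0 < t < 1 -> forall b, 0 < bern t b.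
Proof. by move=> /andP[t0 t1] [] //=; rewrite subr_gt0. Qed.

(** This is minus a relative entropy between two Bernoulli laws: [ln x < x - 1] is applied to both
    ratios, and the weighted right-hand sides sum to 0. *)
Lemma rate_bern_lt0 (s t : R) : 0 < s < 1 -> 0 < t < 1 -> s != t ->
  rate (bern t) s < 0.
Proof.
move=> s01 t01 st; have /= s0 := bern_gt0 s01; have /= t0 := bern_gt0 t01.
have lnlt b : bern s b * ln (bern t b / bern s b) < bern t b - bern s b.
  have -> : bern t b - bern s b = bern s b * (bern t b / bern s b - 1).
    by rewrite mulrBr mulr1 mulrCA mulfV ?mulr1 // gt_eqF.
  rewrite ltr_pM2l //; apply: ln_lt_subr1; first exact: divr_gt0.
  apply: contra_neq (@divr1_eq _ _ _) _.
  by move: st; rewrite eq_sym /bern; case: b => // /eqP st; apply/eqP; lra.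
by have := lnlt true; have := lnlt false; rewrite /rate /logmix /=; lra.
Qed.

Variable mu : bool -> R.
Hypotheses (mu01 : forall b, 0 < mu b < 1) (mu_sum1 : mu false + mu true = 1).

Let mu_gt0 b : 0 < mu b. Proof. by have /andP[] := mu01 b. Qed.

(** It makes the log-density of [mu] relative to [bern t] nondecreasing in the fraction of ones. *)
Lemma tilt_le (t : R) : 0 < t <= mu true ->
  mu false / bern t false <= mu true / bern t true.
Proof.
move=> /andP[t0 tmu]; have /andP[_ mu1] := mu01 true.
apply: (@le_trans _ _ 1) => /=.
  by rewrite ler_pdivrMr ?subr_gt0 ?(le_lt_trans tmu) //;
    move: mu_sum1; lra.
by rewrite ler_pdivlMr // mul1r.
Qed.

Lemma tilt_gt0 (t : R) : 0 < t < 1 -> forall b, 0 < mu b / bern t b.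
Proof. by move=> t01 b; rewrite divr_gt0 // bern_gt0. Qed.

(** [rate mu s] is the value at [s] of the tangent line to [rate mu] at [t], which is nondecreasing,
    plus minus a relative entropy, which is negative. *)
Lemma rate_lt (s t : R) : 0 < s -> s < t -> t <= mu true ->
  rate mu s < rate mu t.
Proof.
move=> s0 st tmu; have /andP[_ mu1] := mu01 true.
have s01 : 0 < s < 1 by lra.
have t01 : 0 < t < 1 by lra.
have -> : rate mu s = logmix (fun b => mu b / bern t b) s + rate (bern t) s.
  rewrite /rate /logmix !ln_div ?posrE ?bern_gt0 //; lra.
have := rate_bern_lt0 s01 t01 (negbT (lt_eqF st)).
have : logmix (fun b => mu b / bern t b) s <= rate mu t.
  apply: logmix_le; rewrite ?tilt_gt0 ?(ltW st) // tilt_le //; lra.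
by lra.
Qed.

Lemma ln_Gfun (t : R) : 0 < t < 1 -> ln (Gfun t (mu true)) = rate mu t.
Proof.
move=> t01; have /andP[t0 t1] := t01; rewrite /Gfun gt_eqF // lt_eqF //.
have -> : 1 - mu true = mu false by rewrite -mu_sum1 addrK.
have := tilt_gt0 t01 true; have := tilt_gt0 t01 false => /= f0 f1.
by rewrite lnM ?posrE ?powR_gt0 // !ln_powR.
Qed.

Lemma rate_mu_true : rate mu (mu true) = 0.
Proof.
have mu0E : 1 - mu true = mu false by rewrite -mu_sum1 addrK.
by rewrite /rate /logmix /= mu0E !divff ?gt_eqF // ln1 !mulr0 addr0.
Qed.

Lemma rate_continuous (t : R) : 0 < t < 1 -> {for t, continuous (rate mu)}.
Proof.
move=> t01; have /andP[t0 t1] := t01.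
have lnc x (f : R -> R) : 0 < x -> 0 < f t -> {for t, continuous f} ->
    {for t, continuous (fun s => ln (x / f s))}.
  move=> x0 ft0 fc; apply: continuous_comp; last first.
    by apply: continuous_ln; exact: divr_gt0.
  by apply: cvgM; [exact: cvg_cst|apply: cvgV; rewrite ?gt_eqF].
apply: cvgD; apply: cvgM => //=.
- by apply: lnc => //; exact: cvg_id.
- by apply: cvgB; [exact: cvg_cst|exact: cvg_id].
- apply: lnc => //=; first by rewrite subr_gt0.
  by apply: cvgB; [exact: cvg_cst|exact: cvg_id].
Qed.

(** Quantitative form of the limit [ln (mu false)] at 0. With argument [t = s^2], the term
    [- t ln t = - 2 s (s ln s)] is at most [2 s], because [- s ln s <= 1]. *)
Lemma rate_sqr_le (s : R) : 0 < s < 1 ->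
  rate mu (s ^+ 2) <= ln (mu false) + s * (3 - ln (mu false)).
Proof.
move=> /andP[s0 s1]; have /andP[m0 m1] := mu01 true.
have ss : 0 < s ^+ 2 < 1 by rewrite exprn_gt0 // exprn_ilt1 // ltW.
have /andP[ss0 ss1] := ss; have lnmu : ln (mu true) <= 0 by exact/ln_le0/ltW.
have lnmu0 : ln (mu false) <= 0 by apply/ln_le0/ltW; have /andP[] := mu01 false.
have sss : s ^+ 2 < s by rewrite expr2 gtr_pMl.
have h1 : - (s * ln s) <= 1.
  rewrite -mulrN -lnV ?posrE //.
  have : ln s^-1 <= s^-1 by apply/ltW/ln_sublinear; rewrite invr_gt0.
  by rewrite -(ler_pM2l s0) divff ?gt_eqF.
have h2 : - ((1 - s ^+ 2) * ln (1 - s ^+ 2)) <= s ^+ 2.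
  have t0 : 0 < 1 - s ^+ 2 by lra.
  rewrite -mulrN -lnV ?posrE //.
  have : ln (1 - s ^+ 2)^-1 <= (1 - s ^+ 2)^-1 - 1.
    have : 0 < (1 - s ^+ 2)^-1 by rewrite invr_gt0.
    set y := _^-1 => y0; rewrite -{1}(subrK 1 y) [_ + 1]addrC.
    by apply: le_ln1Dx; lra.
  by rewrite -(ler_pM2l t0) mulrBr divff ?gt_eqF //; lra.
rewrite /rate /logmix /= !ln_div ?posrE //; last by lra.
rewrite lnXn // mulr2n; move: h1 h2; rewrite expr2 in ss0 sss *.
set a := ln (mu true) in lnmu *; set b := ln (mu false) in lnmu0 *.
set c := ln s; set d := ln (1 - s * s) => h1 h2.
have h3 : s * s * a <= 0 by rewrite mulr_ge0_le0 // ltW.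
have h4 : - (s * (s * c)) <= s.
  by rewrite -mulrN -[leRHS]mulr1 ler_pM2l.
have h5 : - (s * s * b) <= - (s * b) by rewrite -!mulrN ler_wpM2r ?oppr_ge0 // ltW.
lra.
Qed.

Lemma rate_eq_exists (r : R) : ln (mu false) < r < 0 ->
  exists2 t, 0 < t < mu true & rate mu t = r.
Proof.
move=> /andP[rmu r0]; have /andP[m0 m1] := mu01 true.
have lnmu0 : ln (mu false) <= 0 by apply/ln_le0/ltW; have /andP[] := mu01 false.
set K := 3 - ln (mu false); have K0 : 0 < K by rewrite /K; lra.
(* Small enough that [rate_sqr_le] gives a value at most [r] at the left endpoint [s ^+ 2], which
   stays below [mu true]. *)
pose s := Num.min (mu true) ((r - ln (mu false)) / K).
have s0 : 0 < s by rewrite lt_min m0 divr_gt0 // subr_gt0.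
have smu : s <= mu true by rewrite ge_min lexx.
have sK : s * K <= r - ln (mu false) by rewrite -ler_pdivlMr // ge_min lexx orbT.
have s1 : 0 < s < 1 by lra.
have ss0 : 0 < s ^+ 2 by rewrite exprn_gt0.
have ssmu : s ^+ 2 < mu true.
  by apply: lt_le_trans smu; rewrite expr2 gtr_pMl //; lra.
have rs : rate mu (s ^+ 2) <= r by have := rate_sqr_le s1; rewrite -/K; lra.
have [|||t /itvP tI rt] := @IVT R (rate mu) (s ^+ 2) (mu true) r.
- exact: ltW.
- apply: continuous_in_subspaceT => t; rewrite inE /= in_itv /= => tI.
  by apply: rate_continuous; lra.
- by rewrite rate_mu_true ge_min rs /= le_max (ltW r0) orbT.
exists t => //; rewrite (lt_le_trans ss0) ?tI //= lt_neqAle tI andbT.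
by apply: contraTneq r0 => tmu; rewrite -rt tmu rate_mu_true ltxx.
Qed.

(** * Attribute vectors of length [L]: change of measure, Chernoff and Chebyshev bounds *)

Variable L : nat.
Hypothesis L_gt0 : (0 < L)%N.
Local Notation vec := {ffun 'I_L -> bool}.

Let L0 : 0 < L%:R :> R. Proof. by rewrite ltr0n. Qed.

Lemma vprod_logmix (x : bool -> R) (b : vec) : (forall c, 0 < x c) ->
  vprod x b = expR (L%:R * logmix x (freq b)).
Proof.
move=> x0.
have -> : L%:R * logmix x (freq b) =
    (\sum_l (b l)%:R) * ln (x true) + \sum_l (1 - (b l)%:R) * ln (x false).
  rewrite -mulr_suml sumrB sumr_const card_ord /logmix /freq.
  by field; rewrite gt_eqF.
rewrite mulr_suml -big_split /= expR_sum; apply: eq_bigr => l _.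
by case: (b l); rewrite ?subrr ?subr0 ?mul0r ?mul1r ?addr0 ?add0r lnK ?posrE.
Qed.

Lemma vprod_tilt (t : R) (b : vec) : 0 < t < 1 ->
  vprod mu b = vprod (bern t) b *
               expR (L%:R * logmix (fun c => mu c / bern t c) (freq b)).
Proof.
move=> t01; rewrite -vprod_logmix; last exact: tilt_gt0.
rewrite -big_split; apply: eq_bigr => l _ /=.
by rewrite mulrCA mulfV ?mulr1 // gt_eqF // bern_gt0.
Qed.

Lemma sum_vprod_bern (t : R) : \sum_(b : vec) vprod (bern t) b = 1.
Proof. by apply: sum_iid1; rewrite sum_bool /= subrK. Qed.

Lemma vprod_bern_ge0 (t : R) (b : vec) : 0 < t < 1 -> 0 <= vprod (bern t) b.
Proof. by move=> t01; apply: prodr_ge0 => l _; apply/ltW/bern_gt0. Qed.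

(** On [freq b <= t] the density relative to [bern t] is at most its value at fraction [t], which is
    [expR (L * rate mu t)]. *)
Lemma freq_upper_bound (t : R) : 0 < t <= mu true ->
  \sum_(b : vec | freq b <= t) vprod mu b <= expR (L%:R * rate mu t).
Proof.
move=> t0; have /andP[_ mu1] := mu01 true; have t01 : 0 < t < 1 by lra.
rewrite -[leRHS]mul1r -{1}(sum_vprod_bern t) mulr_suml big_mkcond /=.
apply: ler_sum => b _; case: ifP => [bt|_]; last first.
  by rewrite mulr_ge0 ?vprod_bern_ge0 // expR_ge0.
rewrite (vprod_tilt _ t01) ler_wpM2l ?vprod_bern_ge0 // ler_expR ler_pM2l //.
by apply: logmix_le; rewrite ?tilt_gt0 ?tilt_le.
Qed.

Lemma freq_chebyshev (t e : R) : 0 < t < 1 -> 0 < e ->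
  1 - (e ^+ 2 * L%:R)^-1 <=
  \sum_(b : vec | `|freq b - t| <= e) vprod (bern t) b.
Proof.
move=> t01 e0; have e2 : 0 < e ^+ 2 by rewrite exprn_gt0.
have var : \sum_(b : vec) vprod (bern t) b * (freq b - t) ^+ 2 <= L%:R^-1.
  have g0 : \sum_c bern t c * (c%:R - t) = 0 by rewrite sum_bool /=; ring.
  have := sum_iid_variance 'I_L _ g0; rewrite sum_bool /= subrK card_ord.
  move=> /(_ erefl) V.
  have -> : \sum_(b : vec) vprod (bern t) b * (freq b - t) ^+ 2 =
      (L%:R * \sum_c bern t c * (c%:R - t) ^+ 2) / L%:R ^+ 2.
    rewrite -V mulr_suml; apply: eq_bigr => b _; rewrite -mulrA; congr (_ * _).
    rewrite -expr_div_n; congr (_ ^+ 2).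
    rewrite sumrB sumr_const card_ord -[t *+ L]mulr_natr mulrBl mulfK //.
    by rewrite gt_eqF.
  rewrite ler_pdivrMr ?exprn_gt0 // [_%:R ^+ 2]expr2 mulKf ?gt_eqF //.
  (* The variance [t (1 - t)] of one coordinate is at most 1. *)
  by rewrite ger_pMr // sum_bool /=; nra.
rewrite lerBlDr -{1}(sum_vprod_bern t) (bigID (fun b => `|freq b - t| <= e)) /=.
rewrite lerD2l invfM; apply: le_trans (_ : (e ^+ 2)^-1 *
  \sum_(b : vec) vprod (bern t) b * (freq b - t) ^+ 2 <= _); last first.
  by rewrite ler_pM2l ?invr_gt0.
rewrite mulr_sumr big_mkcond /=; apply: ler_sum => b _.
have w0 := vprod_bern_ge0 b t01.
rewrite -ltNge; case: ifP => [eb|_]; last first.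
  by rewrite mulr_ge0 ?invr_ge0 ?(ltW e2) // mulr_ge0 ?sqr_ge0.
rewrite mulrCA ler_peMr // mulrC ler_pdivlMr // mul1r -(real_normK (num_real (_ - _))).
by rewrite ler_pXn2r ?nnegrE ?normr_ge0 ?(ltW e0) // ltW.
Qed.

(** On the window the density relative to [bern t] is at least its value at the left end [t - e]. *)
Lemma freq_lower_bound (t e : R) : 0 < t <= mu true -> 0 < e ->
  (1 - (e ^+ 2 * L%:R)^-1) *
    expR (L%:R * logmix (fun c => mu c / bern t c) (t - e)) <=
  \sum_(b : vec | `|freq b - t| <= e) vprod mu b.
Proof.
move=> t0 e0; have /andP[_ mu1] := mu01 true; have t01 : 0 < t < 1 by lra.
apply: (le_trans (ler_wpM2r (expR_ge0 _) (freq_chebyshev t01 e0))).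
rewrite mulr_suml; apply: ler_sum => b; rewrite ler_distl => /andP[be _].
rewrite (vprod_tilt _ t01) ler_wpM2l ?vprod_bern_ge0 // ler_expR ler_pM2l //.
by apply: logmix_le; rewrite ?tilt_gt0 ?tilt_le.
Qed.

End LargeDeviations.

(** * Admissible scalings *)

Section Asymptotics.
Variables (R : realType) (rho : R) (L : nat -> nat).
Hypotheses (rho_gt0 : 0 < rho) (L_adm : admissible rho L).

Lemma ln_natr_cvgy : ln (n%:R : R) @[n --> \oo] --> +oo.
Proof.
apply/cvgryPge => A; near=> n.
have An : expR A <= n%:R by near: n; exact: nbhs_infty_ger.
by rewrite -(expRK A) ler_ln ?posrE ?expR_gt0 // (lt_le_trans _ An) ?expR_gt0.
Unshelve. all: by end_near. Qed.

Lemma expR_ln_natr_cvg0 (d : R) : 0 < d ->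
  expR (- (d * ln (n%:R : R))) @[n --> \oo] --> 0.
Proof.
move=> d0; apply: (@cvg_comp _ _ _ (fun n => d * ln (n%:R : R)) (fun x => expR (- x)))
  (@cvgr_expR R).
apply/cvgryPge => A; near=> n.
rewrite mulrC -ler_pdivrMr //; near: n.
by move/cvgryPge : ln_natr_cvgy; apply.
Unshelve. all: by end_near. Qed.

Lemma admissible_ratio (c : R) :
  1 + rho * ((L n)%:R / (rho * ln (n%:R : R))) * c @[n --> \oo] --> 1 + rho * c.
Proof.
rewrite -[in X in _ --> X](mulr1 rho).
apply: cvgD; first exact: cvg_cst.
apply: cvgM; last exact: cvg_cst.
by apply: cvgM; [exact: cvg_cst|exact: L_adm.2].
Qed.

(** With [s = ln n] and [l = L n] the bracket tends to [1 + rho * c], whose sign then decides the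
    growth. *)
Lemma ln_addE (c s l : R) : 0 < s ->
  s + l * c = s * (1 + rho * (l / (rho * s)) * c).
Proof. by move=> s0; field; rewrite !gt_eqF. Qed.

Lemma ln_natr_gt0 : \forall n \near \oo, 0 < ln (n%:R : R).
Proof. by have /cvgryPgt := ln_natr_cvgy; apply. Qed.

Lemma admissible_subcritical (c : R) : 1 + rho * c < 0 ->
  exists2 d : R, 0 < d &
    \forall n \near \oo, ln n%:R + (L n)%:R * c <= - (d * ln n%:R).
Proof.
(* Half the limit leaves room for the convergence of the ratio. *)
move=> c0; exists (- (1 + rho * c) / 2); first by lra.
near=> n; have s0 : 0 < ln (n%:R : R) by near: n; exact: ln_natr_gt0.
rewrite ln_addE // mulrC -mulNr ler_pM2r // -mulNr opprK.
near: n; by apply: (cvgr_le _ (@admissible_ratio c)); lra.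
Unshelve. all: by end_near. Qed.

Lemma admissible_supercritical (c : R) : 0 < 1 + rho * c ->
  exists2 d : R, 0 < d &
    \forall n \near \oo, d * ln n%:R <= ln n%:R + (L n)%:R * c.
Proof.
move=> c0; exists ((1 + rho * c) / 2); first by lra.
near=> n; have s0 : 0 < ln (n%:R : R) by near: n; exact: ln_natr_gt0.
rewrite ln_addE // mulrC ler_pM2l //.
near: n; by apply: (cvgr_ge _ (@admissible_ratio c)); lra.
Unshelve. all: by end_near. Qed.

Lemma natr_expR (n : nat) (x : R) : (0 < n)%N ->
  n%:R * expR x = expR (ln n%:R + x).
Proof. by move=> n0; rewrite expRD lnK // posrE ltr0n. Qed.

Lemma subcritical_cvg0 (c : R) : 1 + rho * c < 0 ->
  n%:R * expR ((L n)%:R * c) @[n --> \oo] --> (0 : R).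
Proof.
move=> /admissible_subcritical[d d0 dn].
apply: squeeze_cvgr (cvg_cst 0) (@expR_ln_natr_cvg0 _ d0).
near=> n; rewrite mulr_ge0 ?expR_ge0 //= natr_expR; last first.
  by near: n; exact: nbhs_infty_ge.
by rewrite ler_expR; near: n.
Unshelve. all: by end_near. Qed.

Lemma supercritical_inv_cvg0 (c : R) : 0 < 1 + rho * c ->
  (n%:R * expR ((L n)%:R * c))^-1 @[n --> \oo] --> (0 : R).
Proof.
move=> /admissible_supercritical[d d0 dn].
apply: squeeze_cvgr (cvg_cst 0) (@expR_ln_natr_cvg0 _ d0).
near=> n; rewrite invr_ge0 mulr_ge0 ?expR_ge0 //= natr_expR; last first.
  by near: n; exact: nbhs_infty_ge.
by rewrite -expRN ler_expR lerN2; near: n.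
Unshelve. all: by end_near. Qed.

(** With [p = expR (L c)], [n p >= n^d] gives [(n - 1) p >= 2 ln n] eventually; as
    [(1 - p)^(n-1) <= expR (- (n - 1) p)], the quantity is at most [1 / n]. *)
Lemma supercritical_power_cvg0 (c : R) : 0 < 1 + rho * c -> c <= 0 ->
  n%:R * (1 - expR ((L n)%:R * c)) ^+ n.-1 @[n --> \oo] --> (0 : R).
Proof.
move=> /admissible_supercritical[d d0 dn] c0.
apply: squeeze_cvgr (cvg_cst 0) (@expR_ln_natr_cvg0 _ ltr01).
near=> n; have ln0 : 0 < ln (n%:R : R) by near: n; exact: ln_natr_gt0.
(* This threshold gives [2 * s <= (d * s) ^+ 2 / 4] below, where [s = ln n]. *)
have lnd : 8 / d ^+ 2 <= ln (n%:R : R).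
  by near: n; move/cvgryPge : ln_natr_cvgy; apply.
have dln : d * ln n%:R <= ln n%:R + (L n)%:R * c by near: n.
have n2 : (1 < n)%N by near: n; exact: nbhs_infty_ge.
have n0 : (0 < n)%N by exact: ltnW.
move: ln0 lnd dln; set s := ln n%:R => s0 sd dln; set p := expR _.
have p1 : 0 <= 1 - p by rewrite subr_ge0 -expR0 ler_expR mulr_ge0_le0.
rewrite mulr_ge0 ?exprn_ge0 //= mul1r.
have np : (d * s) ^+ 2 / 2 <= n%:R * p.
  rewrite natr_expR //; apply: (@le_trans _ _ (expR (d * s))).
    have ds0 : 0 <= d * s by rewrite mulr_ge0 // ltW.
    by apply: le_trans (expR_ge1Dxn 1 ds0); rewrite ler_wpDl.
  by rewrite ler_expR.
have n1p : (d * s) ^+ 2 / 4 <= n.-1%:R * p.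
  have : n%:R <= 2 * n.-1%:R :> R.
    by rewrite -natrM ler_nat mul2n -addnn -{1}(prednK n0) -addn1 leq_add2l -ltnS prednK.
  by rewrite -(ler_pM2r (expR_gt0 ((L n)%:R * c))) -/p; lra.
have s2 : 2 * s <= (d * s) ^+ 2 / 4.
  move: sd; rewrite ler_pdivrMr ?exprn_gt0 // exprMn => sd.
  have : s * 8 <= s * (s * d ^+ 2) by rewrite ler_pM2l.
  by rewrite [s ^+ 2]expr2; lra.
apply: (@le_trans _ _ (n%:R * expR (- p) ^+ n.-1)).
  rewrite ler_wpM2l // lerXn2r ?nnegrE ?expR_ge0 //.
  exact: expR_ge1Dx.
rewrite -expRM_natl natr_expR // ler_expR -/s; lra.
Unshelve. all: by end_near. Qed.

Lemma admissible_large (A : R) : \forall n \near \oo, A <= (L n)%:R.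
Proof.
near=> n; have s0 : 0 < ln (n%:R : R) by near: n; exact: ln_natr_gt0.
have : 2^-1 <= (L n)%:R / (rho * ln n%:R).
  near: n; by apply: (cvgr_ge _ L_adm.2); lra.
rewrite ler_pdivlMr ?mulr_gt0 //; apply: le_trans.
have : `|A| * 2 / rho <= ln n%:R.
  by near: n; move/cvgryPge : ln_natr_cvgy; apply.
by rewrite ler_pdivrMr //; have := ler_norm A; lra.
Unshelve. all: by end_near. Qed.

End Asymptotics.

(** * Zero-one law *)

Section ZeroOneLaw.
Variables (R : realType) (mu : bool -> R) (q : bool -> bool -> R) (rho : R).
Variable L : nat -> nat.
Hypotheses (mu01 : forall b, 0 < mu b < 1) (mu_sum1 : mu false + mu true = 1)
  (q_sym : q false true = q true false) (q01 : forall a b, 0 < q a b < 1)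
  (rho_gt0 : 0 < rho) (Gamma_lt : Gamma mu q false < Gamma mu q true)
  (L_adm : admissible rho L).

Let Gamma_gt0 b : 0 < Gamma mu q b.
Proof. by have /andP[] := Gamma_itv mu01 mu_sum1 q01 b. Qed.

Lemma exists_small (K h m : R) : 0 < h -> 0 < m ->
  exists e, [/\ 0 < e, e < m & e * K < h].
Proof.
move=> h0 m0; have K0 : 0 < `|K| + 1 by rewrite ltr_wpDl.
(* [|K| + 1] is a positive bound for [K] whatever its sign. *)
exists (Num.min (m / 2) (h / (`|K| + 1))).
set e := Num.min _ _; have e0 : 0 < e by rewrite lt_min !divr_gt0.
have em : e <= m / 2 by rewrite ge_min lexx.
have : e <= h / (`|K| + 1) by rewrite ge_min lexx orbT.
rewrite ler_pdivlMr // => eK; split => //; first by lra.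
have : e * K <= e * `|K| by rewrite ler_wpM2l ?ler_norm // ltW.
by lra.
Qed.

Lemma logmixD (x : bool -> R) (t e : R) :
  logmix x (t + e) = logmix x t + e * (ln (x true) - ln (x false)).
Proof. by rewrite /logmix; ring. Qed.

Lemma logmix_Gamma_le0 (t : R) : 0 <= t <= 1 -> logmix (Gamma mu q) t <= 0.
Proof.
move=> /andP[t0 t1].
have lnG b : ln (Gamma mu q b) <= 0.
  by apply/ln_le0/ltW; have /andP[] := Gamma_itv mu01 mu_sum1 q01 b.
have := lnG true; have := lnG false; rewrite /logmix; nra.
Qed.

(** The two conditions serve the two kinds of nodes: those with [freq b <= t] vanish in mean, and
    all others have [vprod (Gamma mu q) b >= p n]. *)
Lemma one_law_at (t : R) : 0 < t <= mu true -> 1 + rho * rate mu t < 0 ->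
  0 < 1 + rho * logmix (Gamma mu q) t ->
  prob_no_isolated mu q n (L n) @[n --> \oo] --> (1 : R).
Proof.
move=> t0 rt ht; have /andP[_ mu1] := mu01 true.
set p := fun n => expR ((L n)%:R * logmix (Gamma mu q) t).
have t01 : 0 <= t <= 1 by lra.
have lim1 : 1 - (n%:R * expR ((L n)%:R * rate mu t) +
    n%:R * (1 - p n) ^+ n.-1) @[n --> \oo] --> (1 : R).
  rewrite -[X in _ --> X]subr0; apply: cvgB; first exact: cvg_cst.
  rewrite -[X in _ --> X]addr0; apply: cvgD; first exact: subcritical_cvg0 rt.
  exact: supercritical_power_cvg0 ht (logmix_Gamma_le0 t01).
apply: squeeze_cvgr lim1 (cvg_cst (1 : R)).
apply: nearW => n; rewrite prob_no_isolated_le1 // andbT.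
apply: le_trans (prob_no_isolated_ge _ _ mu01 mu_sum1 q_sym q01).
rewrite lerB // -/(p n) -mulrDr ler_wpM2l //.
have Ln0 := L_adm.1 n.
rewrite (bigID (fun b => freq R b <= t)) /=; apply: lerD.
  apply: le_trans (freq_upper_bound mu01 mu_sum1 Ln0 t0).
  apply: ler_sum => b _; rewrite ler_piMr ?node_weight_ge0 //.
  have /andP[G0 G1] := prod_Gamma_itv mu01 mu_sum1 q01 b.
  by rewrite exprn_ile1 ?subr_ge0 // gerBl.
rewrite -[leRHS]mul1r -[X in _ <= X * _](sum_node_weight (L n) mu_sum1) mulr_suml big_mkcond /=.
apply: ler_sum => b _; have w0 := node_weight_ge0 mu01 b.
have p1 : p n <= 1.
  by rewrite -expR0 ler_expR mulr_ge0_le0 // logmix_Gamma_le0.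
case: ifP => [|_]; last by rewrite mulr_ge0 // exprn_ge0 // subr_ge0.
rewrite -ltNge => tb; rewrite ler_wpM2l //.
have /andP[_ G1] := prod_Gamma_itv mu01 mu_sum1 q01 b.
rewrite lerXn2r ?nnegrE ?subr_ge0 // lerB // (vprod_logmix Ln0) //.
by rewrite ler_expR ler_wpM2l // logmix_le // ltW.
Qed.

(** The left end of the window bounds its probability from below, the right end bounds the adjacency
    probability from above. *)
Lemma zero_law_at (t e : R) : 0 < t <= mu true -> 0 < e ->
  0 < 1 + rho * logmix (fun b => mu b / bern t b) (t - e) ->
  1 + rho * logmix (Gamma mu q) (t + e) < 0 ->
  prob_no_isolated mu q n (L n) @[n --> \oo] --> (0 : R).
Proof.
move=> t0 e0 rt ht; set c := logmix _ (t - e) in rt.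
set g := logmix _ (t + e) in ht.
have lim0 : 2 * (n%:R * expR ((L n)%:R * g)) +
    2 * (n%:R * expR ((L n)%:R * c))^-1 @[n --> \oo] --> (0 : R).
  rewrite -[X in _ --> X]addr0 -[X in X + _](mulr0 2) -[X in _ + X](mulr0 2).
  apply: cvgD; (apply: cvgM; first exact: cvg_cst).
    exact: subcritical_cvg0 ht.
  exact: supercritical_inv_cvg0 rt.
apply: squeeze_cvgr (cvg_cst (0 : R)) lim0.
near=> n; rewrite prob_no_isolated_ge0 //=.
have Ln0 := L_adm.1 n.
have n0 : 0 < n%:R :> R by rewrite ltr0n; near: n; exact: nbhs_infty_ge.
(* The Chebyshev error is then at most 1/2. *)
have Le : 2 / e ^+ 2 <= (L n)%:R by near: n; exact: admissible_large L_adm _.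
pose tau (b : {ffun 'I_(L n) -> bool}) := `|freq R b - t| <= e.
have Gtau b : tau b -> vprod (Gamma mu q) b <= expR ((L n)%:R * g).
  rewrite /tau ler_distl => /andP[_ bt].
  by rewrite (vprod_logmix Ln0) // ler_expR ler_wpM2l // logmix_le // ltW.
have Ptau : 2^-1 * expR ((L n)%:R * c) <= \sum_(b | tau b) vprod mu b.
  apply: le_trans (freq_lower_bound mu01 mu_sum1 Ln0 t0 e0).
  rewrite ler_wpM2r ?expR_ge0 //.
  have : (e ^+ 2 * (L n)%:R)^-1 <= 2^-1.
    rewrite lef_pV2 ?posrE ?mulr_gt0 ?exprn_gt0 ?ltr0n // mulrC.
    by rewrite -ler_pdivrMr ?exprn_gt0.
  by lra.
have P0 : 0 < 2^-1 * (n%:R * expR ((L n)%:R * c)).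
  by rewrite !mulr_gt0 ?expR_gt0.
have Pn : 2^-1 * (n%:R * expR ((L n)%:R * c)) <=
    n%:R * \sum_(b | tau b) vprod mu b.
  by rewrite mulrCA ler_pM2l.
have /= := prob_no_isolated_le mu01 mu_sum1 q_sym q01 Gtau (lt_le_trans P0 Pn).
move=> /le_trans; apply; rewrite -mulrA lerD2l.
have invE (y : R) : 2 * y^-1 = (2^-1 * y)^-1 by rewrite invfM invrK.
by rewrite invE lef_pV2 ?posrE ?(lt_le_trans P0).
Unshelve. all: by end_near. Qed.

Lemma ln_powR_Gamma (t : R) :
  ln (Gamma mu q true `^ t * Gamma mu q false `^ (1 - t)) =
  logmix (Gamma mu q) t.
Proof. by rewrite lnM ?posrE ?powR_gt0 // !ln_powR. Qed.

Lemma zero_one_law (t : R) : 0 < t < mu true -> 1 + rho * rate mu t = 0 ->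
  (1 + rho * logmix (Gamma mu q) t < 0 ->
     prob_no_isolated mu q n (L n) @[n --> \oo] --> (0 : R)) /\
  (0 < 1 + rho * logmix (Gamma mu q) t ->
     prob_no_isolated mu q n (L n) @[n --> \oo] --> (1 : R)).
Proof.
move=> /andP[t0 tmu] rt; set D := ln (Gamma mu q true) - ln (Gamma mu q false).
split=> ht.
- have h0 : 0 < - (1 + rho * logmix (Gamma mu q) t) by rewrite oppr_gt0.
  (* At [t] itself the mean number of nodes has exponent 0; moving right by [d] makes it positive,
     and a small [d] keeps the exponent for [Gamma] negative. *)
  have [d [d0 dmu dD]] : exists d, [/\ 0 < d, d < mu true - t & d * (rho * D) <
      - (1 + rho * logmix (Gamma mu q) t)].
    by apply: exists_small; rewrite ?subr_gt0.
  have ht' : 0 < - (1 + rho * logmix (Gamma mu q) (t + d)).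
    by rewrite logmixD -/D; lra.
  have rt' : 0 < 1 + rho * rate mu (t + d).
    have : rate mu t < rate mu (t + d) by apply: rate_lt => //; lra.
    by rewrite -(ltr_pM2l rho_gt0); lra.
  set x := fun b => mu b / bern (t + d) b.
  set K := rho * (ln (x true) - ln (x false)).
  (* [e1] keeps the left end of the window supercritical, and so does any [e < e1] because [K >= 0];
     [e] also keeps the right end subcritical. *)
  have [e1 [e10 _ eK]] := exists_small K rt' ltr01.
  have [e [e_gt0 ee1 eD]] := exists_small (rho * D) ht' e10.
  apply: (@zero_law_at (t + d) e) => //; first by lra.
    rewrite -/x logmixD -[logmix x _]/(rate mu (t + d)).
    have : e * K < 1 + rho * rate mu (t + d).
      apply: le_lt_trans eK; rewrite ler_wpM2r ?(ltW ee1) //.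
      rewrite mulr_ge0 ?(ltW rho_gt0) // subr_ge0.
      have tmu' : 0 < t + d <= mu true by lra.
      have /andP[_ mu1] := mu01 true; have t01 : 0 < t + d < 1 by lra.
      by rewrite ler_ln ?posrE ?tilt_gt0 // tilt_le.
    by rewrite /K; lra.
  by rewrite logmixD -/D; lra.
(* Moving left by [e < t] makes the rate exponent negative; a small [e] keeps the exponent for
   [Gamma] positive. *)
- have [e [e0 et eD]] := exists_small (rho * D) ht t0.
  apply: (@one_law_at (t - e)); first by lra.
    have : rate mu (t - e) < rate mu t by apply: rate_lt => //; lra.
    by rewrite -(ltr_pM2l rho_gt0); lra.
  by rewrite logmixD -/D; lra.
Qed.

End ZeroOneLaw.

(** * Existence and uniqueness of [nu_star], and the two limits *)

Unset Implicit Arguments.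

Theorem theorem2 (R : realType) (mu : bool -> R) (q : bool -> bool -> R)
  (rho : R)
  (Hmu : forall b, 0 < mu b < 1) (Hmusum : mu false + mu true = 1)
  (Hqsym : q false true = q true false) (Hq : forall a b, 0 < q a b < 1)
  (Hrho : 0 < rho)
  (HGamma : Gamma mu q false < Gamma mu q true)
  (Hmu0 : 1 + rho * ln (mu false) < 0) :
  (exists! nu : R, (0 < nu < mu true) /\ 1 + rho * ln (Gfun nu (mu true)) = 0) /\
  (forall nu_star : R, 0 < nu_star < mu true ->
     1 + rho * ln (Gfun nu_star (mu true)) = 0 ->
     forall L : nat -> nat, admissible rho L ->
       (1 + rho * ln ((Gamma mu q true) `^ nu_star *
                      (Gamma mu q false) `^ (1 - nu_star)) < 0 ->
          (fun n : nat => prob_no_isolated mu q n (L n)) @ \oo --> (0 : R)) /\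
       (1 + rho * ln ((Gamma mu q true) `^ nu_star *
                      (Gamma mu q false) `^ (1 - nu_star)) > 0 ->
          (fun n : nat => prob_no_isolated mu q n (L n)) @ \oo --> (1 : R))).
Proof.
have rho_neq0 : rho != 0 by rewrite gt_eqF.
have /andP[_ mu1] := Hmu true.
have rateE nu : 0 < nu < mu true ->
    (1 + rho * ln (Gfun nu (mu true)) = 0) <-> rate mu nu = - rho^-1.
  move=> nu0; rewrite ln_Gfun //; last by lra.
  split => [h|->]; last by rewrite mulrN mulfV // subrr.
  by apply: (mulfI rho_neq0); rewrite mulrN mulfV //; lra.
split.
  have [|nu nu0 rnu] := @rate_eq_exists R mu Hmu Hmusum (- rho^-1).
    (* [Hmu0] says that [- rho^-1] exceeds [ln (mu false)], the limit of the rate at 0. *)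
    rewrite oppr_lt0 invr_gt0 Hrho andbT -(ltr_pM2l Hrho) mulrN mulfV //; lra.
  exists nu; split; first by split=> //; apply/rateE.
  move=> nu' [nu'0 /(rateE _ nu'0) rnu'].
  have [lt|lt|//] := ltgtP nu nu'.
    by have := rate_lt Hmu Hmusum (s := nu) (t := nu'); rewrite rnu rnu'; lra.
  by have := rate_lt Hmu Hmusum (s := nu') (t := nu); rewrite rnu rnu'; lra.
move=> nu nu0 /(rateE _ nu0) rnu L Ladm.
rewrite (ln_powR_Gamma Hmu Hmusum Hq).
apply: zero_one_law => //.
by rewrite rnu mulrN mulfV // subrr.
Qed.
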